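(* There are absolute constants $C,C'>0$ such that for every $n\ge 2$ and every connected simple undirected graph $G_0$ on $n$ nodes, the two-hop walk process started from $G_0$ satisfies: with probability at least $1-C'\frac{\log n}{n}$, the graph $G_T$ with $T=\lceil Cn\log^2 n\rceil$ is the complete graph on the $n$ nodes.
   Context: Two-hop walk process (undirected): $G_0$ is a connected simple undirected graph on an $n$-node vertex set $V$. Given $G_t$, in round $t$ every node $x$ independently picks a neighbor $v$ of $x$ in $G_t$ uniformly at random, then a neighbor $w$ of $v$ in $G_t$ uniformly at random, and the edge $\{x,w\}$ is added (nothing happens if $w=x$ or the edge already exists); $G_{t+1}$ is $G_t$ together with all edges added in round $t$. Edges are never removed. *)

(* Defs.v *)
From Stdlib Require Import Reals.
From mathcomp Require Import all_boot.
Set Implicit Arguments. Unset Strict Implicit. Unset Printing Implicit Defensive.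

Definition graph (n : nat) := {set 'I_n * 'I_n}.

Definition simple_undirected n (G : graph n) : Prop :=
  (forall x y : 'I_n, (x, y) \in G -> (y, x) \in G) /\
  (forall x : 'I_n, (x, x) \notin G).

Definition adj n (G : graph n) : rel 'I_n := fun x y => (x, y) \in G.

Definition connected_graph n (G : graph n) : Prop :=
  forall x y : 'I_n, connect (adj G) x y.

Definition complete_graph n : graph n := [set e : 'I_n * 'I_n | e.1 != e.2].

Definition nbr n (G : graph n) (x : 'I_n) : {set 'I_n} := [set y | (x, y) \in G].

Definition deg n (G : graph n) (x : 'I_n) : nat := #|nbr G x|.

Local Open Scope R_scope.

(* Probability that node x, doing a two-hop walk in G, ends at w:
   x picks v uniformly in N(x), then w uniformly in N(v).
   (An isolated node -- which never occurs in a connected graph with n >= 2,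
   and connectivity is preserved -- is taken to stay at itself, so that this
   is always a probability kernel.) *)
Definition step_prob n (G : graph n) (x w : 'I_n) : R :=
  if deg G x == 0%N then (if w == x then R1 else R0)
  else \big[Rplus/R0]_(v in nbr G x)
         (Rinv (INR (deg G x)) * (Rinv (INR (deg G v)) *
            (if w \in nbr G v then R1 else R0))).

(* Graph after one round, given the endpoint c x chosen by every node x:
   the edge {x, c x} is added for every x with c x <> x. *)
Definition next_graph n (G : graph n) (c : {ffun 'I_n -> 'I_n}) : graph n :=
  G :|: [set e : 'I_n * 'I_n | (e.2 == c e.1) && (e.1 != e.2)]
    :|: [set e : 'I_n * 'I_n | (e.1 == c e.2) && (e.1 != e.2)].

Definition round_prob n (G H : graph n) : R :=
  \big[Rplus/R0]_(c : {ffun 'I_n -> 'I_n})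
     (if next_graph G c == H
      then \big[Rmult/R1]_(x : 'I_n) step_prob G x (c x) else R0).

Fixpoint twohop_dist n (G0 : graph n) (t : nat) : graph n -> R :=
  match t with
  | 0%N => fun H => if H == G0 then R1 else R0
  | t'.+1 => fun H => \big[Rplus/R0]_(G : graph n) (twohop_dist G0 t' G * round_prob G H)
  end.

(* Main.v *)
Require Import Defs.
From Stdlib Require Import Reals.
From mathcomp Require Import all_boot all_order all_algebra.
From mathcomp Require Import Rstruct ring lra zify.
Set Implicit Arguments. Unset Strict Implicit. Unset Printing Implicit Defensive.
Import Order.TTheory GRing.Theory Num.Theory.

(** Call d a lower bound on all degrees. As long as 3d + 2 <= 2n, every degree
    reaches 33d/32 within O(n log n) rounds, except with probability O(1/n);
    after O(log n) such phases any two non-adjacent vertices have n/3 common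
    neighbours, so each missing edge appears at rate 1/O(n).

    For one phase and one vertex u, let A be N[u] together with the outside
    vertices having at least d/4 neighbours in N[u], all taken at the start of
    the phase, and let B be the set of the vertices of A that still have fewer
    than d/4 neighbours outside A. While u has gained fewer than d/32
    neighbours, one of the following holds in every round.
    - Many vertices were absorbed into A: each of them that is not yet adjacent
      to u shares d/4 neighbours with u, so u gains a neighbour at rate Omega(d/n).
    - Many vertices of A have many neighbours outside A: then u steps through
      one of them to a new neighbour with constant probability.
    - Otherwise the number M of edges leaving B grows in expectation by a factor
      1 + Omega(1/d). A vertex w outside B with k < d/4 neighbours in B is
      reached by Omega(kd) walks x -> y -> w with x, y in B, while a vertex w
      with at least d/4 neighbours in B has so many neighbours outside A that
      the walks x -> w -> z lead to new edges leaving B.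
    Hence (3d - deg u) / (M + 1) is multiplied by at most 1 - Omega(1/n) per
    round in expectation, and it is at least d / O(n^2) as long as u has not
    grown, so O(n log n) rounds suffice. *)

Local Open Scope ring_scope.
#[local] Bind Scope ring_scope with R.

(** * The walk kernel, one-round expectations and their iteration *)

Section Walk.
Variable n : nat.
Implicit Types (G H : graph n) (x y v w : 'I_n) (S : {set 'I_n}).

Definition good_graph G : Prop := simple_undirected G /\ connected_graph G.

Lemma nbrP G x y : (y \in nbr G x) = ((x, y) \in G).
Proof. by rewrite inE. Qed.

Lemma nbr_sym G x y : simple_undirected G -> (y \in nbr G x) = (x \in nbr G y).
Proof. by move=> [sG _]; rewrite !nbrP; apply/idP/idP; apply: sG. Qed.

Lemma nbr_irr G x : simple_undirected G -> x \notin nbr G x.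
Proof. by move=> [_ iG]; rewrite nbrP; apply: iG. Qed.

Lemma nbr_neq G x y : simple_undirected G -> y \in nbr G x -> x != y.
Proof. by move=> sG xy; apply: contraTneq xy => ->; apply: nbr_irr. Qed.

(** Rules out the default branch of [step_prob] for isolated vertices. *)
Lemma deg_gt0 G x : (1 < n)%N -> good_graph G -> (0 < deg G x)%N.
Proof.
move=> n1 [sG cG].
have [y yx] : exists y, y != x.
  have: (0 < #|~: [set x]|)%N by rewrite cardsC1 card_ord; lia.
  by case/card_gt0P => y; rewrite !inE => yx; exists y.
case/connectP: (cG x y) => [[|z p] /= pth lst]; first by rewrite lst eqxx in yx.
by case/andP: pth => xz _; apply/card_gt0P; exists z; rewrite nbrP.
Qed.

Lemma deg_ltn G x : simple_undirected G -> (deg G x < n)%N.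
Proof.
move=> sG; rewrite -[X in (_ < X)%N]card_ord; apply: (leq_ltn_trans (n := #|[set~ x]|)).
  by apply: subset_leq_card; apply/subsetP => y xy; rewrite !inE eq_sym (nbr_neq sG xy).
by rewrite cardsC1 card_ord; case: n x => [[]|m _] //=.
Qed.

Lemma nextP G (c : {ffun 'I_n -> 'I_n}) x y :
  ((x, y) \in next_graph G c) =
  ((x, y) \in G) || ((x != y) && ((y == c x) || (x == c y))).
Proof. by rewrite !inE /=; case: (x != y); rewrite ?andbT ?andbF ?orbF ?orbA. Qed.

Lemma next_sub G c : G \subset next_graph G c.
Proof. by apply/subsetP => -[x y] xy; rewrite nextP xy. Qed.

Lemma next_good G c : good_graph G -> good_graph (next_graph G c).
Proof.
move=> [[sG iG] cG]; split; last first.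
  move=> x y; apply: connect_sub (cG x y) => a b ab; apply: connect1.
  by move: ab; rewrite /= /adj nextP => ->.
split=> [x y|x]; last by rewrite nextP eqxx orbF iG.
rewrite !nextP => /orP[/sG->//|/andP[xy /orP[E|E]]];
  by rewrite eq_sym xy E ?orbT.
Qed.

Lemma nbr_sub G H x : G \subset H -> nbr G x \subset nbr H x.
Proof. by move=> /subsetP GH; apply/subsetP => y; rewrite !nbrP => /GH. Qed.

Lemma step_probE G x w : step_prob G x w =
  if deg G x == 0%N then (w == x)%:R
  else \sum_(v in nbr G x) (deg G x)%:R^-1 * ((deg G v)%:R^-1 * (w \in nbr G v)%:R).
Proof.
rewrite /step_prob; case: ifP => _; first by case: ifP.
apply: eq_bigr => v _; rewrite !INRE /=.
by case: ifP.
Qed.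

Lemma step_prob_ge0 G x w : 0 <= step_prob G x w.
Proof.
rewrite step_probE; case: ifP => _ //.
by apply: sumr_ge0 => v _; rewrite !mulr_ge0 ?invr_ge0 ?ler0n.
Qed.

Lemma step_set G x S : (0 < deg G x)%N ->
  \sum_(w in S) step_prob G x w =
  \sum_(v in nbr G x) (deg G x)%:R^-1 * ((deg G v)%:R^-1 * #|nbr G v :&: S|%:R).
Proof.
move=> d0.
under eq_bigr => w _ do rewrite step_probE ifF ?gtn_eqF //.
rewrite exchange_big /=; apply: eq_bigr => v _.
rewrite -!mulr_sumr -sum1_card natr_sum; congr (_ * (_ * _)).
by under [RHS]eq_bigl => w do rewrite inE andbC; rewrite big_mkcondr; apply: eq_bigr => w _; case: ifP.
Qed.

Lemma step_sum1 G x : (1 < n)%N -> good_graph G -> \sum_w step_prob G x w = 1.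
Proof.
move=> n1 gG; transitivity (\sum_(w in [set: 'I_n]) step_prob G x w).
  by apply: eq_bigl => w; rewrite inE.
rewrite step_set ?deg_gt0 // -mulr_sumr.
rewrite (eq_bigr (fun _ => 1)) => [|v _]; last first.
  by rewrite setIT mulVf // pnatr_eq0 -lt0n deg_gt0.
by rewrite sumr_const mulVf // pnatr_eq0 -lt0n deg_gt0.
Qed.

Definition choice_weight G (c : {ffun 'I_n -> 'I_n}) : R :=
  \prod_x step_prob G x (c x).

Lemma choice_weight_ge0 G c : 0 <= choice_weight G c.
Proof. by apply: prodr_ge0 => x _; apply: step_prob_ge0. Qed.

(** Independence of the choices. With one nontrivial factor it yields the marginals; with the
    factors [1 - 1/N] it controls the number of new cut edges. *)
Lemma choice_prod G (f : 'I_n -> 'I_n -> R) :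
  \sum_c choice_weight G c * \prod_x f x (c x) =
  \prod_x \sum_w step_prob G x w * f x w.
Proof.
rewrite bigA_distr_bigA; apply: eq_bigr => c _.
by rewrite /choice_weight -big_split.
Qed.

Lemma choice_sum1 G : (1 < n)%N -> good_graph G -> \sum_c choice_weight G c = 1.
Proof.
move=> n1 gG.
rewrite /choice_weight -bigA_distr_bigA big1 // => x _.
exact: step_sum1.
Qed.

Lemma choice_marginal G x (f : 'I_n -> R) : (1 < n)%N -> good_graph G ->
  \sum_c choice_weight G c * f (c x) = \sum_w step_prob G x w * f w.
Proof.
move=> n1 gG.
have /= := choice_prod G (fun y w => if y == x then f w else 1).
under eq_bigr => c _ do rewrite -big_mkcond big_pred1_eq.
move=> ->; rewrite (bigD1 x) //= eqxx [X in _ * X]big1 ?mulr1 // => y /negbTE->.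
by under eq_bigr do rewrite mulr1; apply: step_sum1.
Qed.

(** The Markov operator of one round, summed over choices instead of graphs so that independence
    stays visible. *)
Definition round_exp (f : graph n -> R) G : R :=
  \sum_c choice_weight G c * f (next_graph G c).

Lemma round_expE f G : round_exp f G = \sum_H round_prob G H * f H.
Proof.
rewrite /round_exp; under [RHS]eq_bigr => H _.
  rewrite /round_prob mulr_suml.
  over.
rewrite exchange_big /=; apply: eq_bigr => c _.
rewrite (bigD1 (next_graph G c)) //= eqxx [X in _ + X]big1 ?addr0 // => H /negbTE E.
by rewrite eq_sym E mul0r.
Qed.

(** [twohop_dist] splits off the last round and [iter] can split off either end, so the induction
    generalizes [f] and uses [iterSr]. *)
Lemma twohop_distE G0 t f :
  \sum_H twohop_dist G0 t H * f H = iter t round_exp f G0.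
Proof.
elim: t f => [|t IH] f.
  rewrite (bigD1 G0) //= eqxx mul1r [X in _ + X]big1 ?addr0 // => H /negbTE->.
  by rewrite mul0r.
rewrite iterSr -IH.
under eq_bigr => H _ do rewrite /= mulr_suml.
rewrite exchange_big /=; apply: eq_bigr => G _.
by rewrite round_expE mulr_sumr; apply: eq_bigr => H _; rewrite mulrA.
Qed.

Lemma round_exp_le (f g : graph n -> R) G :
  (forall c, f (next_graph G c) <= g (next_graph G c)) ->
  round_exp f G <= round_exp g G.
Proof. by move=> fg; apply: ler_sum => c _; rewrite ler_wpM2l ?choice_weight_ge0. Qed.

Lemma round_exp_affine (a b : R) (f : graph n -> R) G : (1 < n)%N -> good_graph G ->
  round_exp (fun H => a + b * f H) G = a + b * round_exp f G.
Proof.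
move=> n1 gG; rewrite /round_exp; under eq_bigr do rewrite mulrDr.
rewrite big_split /= -mulr_suml choice_sum1 // mul1r mulr_sumr.
by congr (_ + _); apply: eq_bigr => c _; rewrite mulrCA.
Qed.

Lemma round_exp_sum (I : finType) (F : I -> graph n -> R) G :
  round_exp (fun H => \sum_i F i H) G = \sum_i round_exp (F i) G.
Proof.
rewrite /round_exp; under eq_bigr do rewrite mulr_sumr.
by rewrite exchange_big.
Qed.

End Walk.

(** * Double counting, cardinalities and elementary inequalities *)

Lemma sum_nbr_swap n (G : graph n) (X Y : {set 'I_n}) : simple_undirected G ->
  (\sum_(v in X) #|nbr G v :&: Y| = \sum_(w in Y) #|nbr G w :&: X|)%N.
Proof.
move=> sG.
have E (A B : {set 'I_n}) : (\sum_(v in A) #|nbr G v :&: B| =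
    \sum_(v in A) \sum_(w in B) (w \in nbr G v : nat))%N.
  apply: eq_bigr => v _; rewrite -sum1_card.
  under eq_bigl => w do rewrite inE andbC.
  by rewrite big_mkcondr; apply: eq_bigr => w _; case: ifP.
rewrite !E exchange_big /=; apply: eq_bigr => w _; apply: eq_bigr => v _.
by rewrite nbr_sym.
Qed.

Lemma leq_card_setU (T : finType) (A B C : {set T}) :
  A \subset B :|: C -> (#|A| <= #|B| + #|C|)%N.
Proof. by move=> /subset_leq_card/leq_trans-> //; rewrite -cardsUI leq_addr. Qed.

Lemma leq_card_disjoint (T : finType) (A B D : {set T}) :
  A \subset D -> B \subset D -> [disjoint A & B] -> (#|A| + #|B| <= #|D|)%N.
Proof.
move=> AD BD /disjoint_setI0 AB; rewrite -cardsUI AB cards0 addn0.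
by apply: subset_leq_card; rewrite subUset AD BD.
Qed.

Lemma bernoulli_ineq (x : R) (k : nat) : 0 <= x <= 1 -> 1 - k%:R * x <= (1 - x) ^+ k.
Proof.
move=> /andP[x0 x1]; elim: k => [|k IH]; first by rewrite mul0r subr0 expr0.
rewrite exprS; apply: le_trans (ler_wpM2l _ IH); last by rewrite subr_ge0.
have : 0 <= k%:R * x * x by rewrite !mulr_ge0.
by rewrite -natr1; nra.
Qed.

(* Bounds the expectation of [N / (N + k)], for [k] a number of successes of
   independent trials, by an expectation that factorizes over the trials. *)
Lemma ratio_le_power (N k : nat) : (0 < N)%N ->
  N%:R / (N + k)%:R <= (1 + (1 - N%:R^-1) ^+ k) / 2 :> R.
Proof.
move=> N0; have NR : 0 < N%:R :> R by rewrite ltr0n.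
have i01 : 0 <= (N%:R : R)^-1 <= 1 by rewrite invr_ge0 ltW //= invf_le1 // ler1n.
have N1 : N%:R * N%:R^-1 = 1 :> R by rewrite mulfV // gt_eqF.
rewrite natrD ler_pdivrMr; last by rewrite ltr_wpDr.
have p0 : 0 <= (1 - N%:R^-1) ^+ k :> R by apply: exprn_ge0; lra.
have := bernoulli_ineq k i01; move: p0; move: (_ ^+ k) => p p0 pk.
have k0 : 0 <= k%:R :> R by [].
(* For [k > N] the left side is below 1/2. Otherwise Bernoulli reduces the claim to
   [2N <= (2 - k/N)(N + k)], whose right side is [2N + k(1 - k/N)]. *)
have [kN|Nk] := leP (k%:R : Rdefinitions.R) N%:R; last by nra.
have : 0 <= k%:R * (1 - k%:R / N%:R) :> R.
  by rewrite mulr_ge0 // subr_ge0 ler_pdivrMr // mul1r.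
have : (1 - k%:R / N%:R) * (N%:R + k%:R) <= p * (N%:R + k%:R) :> R.
  by rewrite ler_wpM2r // addr_ge0 // ltW.
have -> : (1 - k%:R / N%:R) * (N%:R + k%:R) =
  N%:R + (k%:R * (1 - k%:R / N%:R)) - k%:R * (N%:R * N%:R^-1) :> R by ring.
rewrite N1; nra.
Qed.

(** The induction carries [p (1 + s) <= 1] and [p <= 1]: a new factor gives [(1 - a)(p (1 + s) + p
    a) <= (1 - a)(1 + a) <= 1]. *)
Lemma prod_le_inv_sum (I : finType) (a : I -> R) : (forall i, 0 <= a i <= 1) ->
  \prod_i (1 - a i) <= (1 + \sum_i a i)^-1.
Proof.
move=> a01.
suff [p0 _ s0 ps] : [/\ 0 <= \prod_i (1 - a i), \prod_i (1 - a i) <= 1,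
    0 <= \sum_i a i & \prod_i (1 - a i) * (1 + \sum_i a i) <= 1].
  by rewrite -[X in _ <= X]mul1r ler_pdivlMr // ltr_wpDr.
apply: (big_rec2 (fun p s => [/\ 0 <= p, p <= 1, 0 <= s & p * (1 + s) <= 1])).
  by split; rewrite ?ler01 // addr0 mulr1.
move=> i p s _ [p0 p1 s0 ps]; have /andP[a0 a1] := a01 i.
split; [by rewrite mulr_ge0 // subr_ge0|by apply: mulr_ile1; lra|by rewrite addr_ge0|].
have : (1 - a i) * (p * (1 + s) + p * a i) <= (1 - a i) * (1 + a i).
  apply: ler_wpM2l; first lra.
  by have pa := ler_piMl a0 p1; lra.
nra.
Qed.

(** * One phase seen from one vertex: the cluster around [u] and the rate at which [u] gains
    neighbours *)

Section Phase.
Variables (n : nat) (G0 : graph n) (u : 'I_n) (d : nat).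
Implicit Types (G H : graph n) (x y v w : 'I_n) (S : {set 'I_n})
  (c : {ffun 'I_n -> 'I_n}).

(* All these sets depend on the graph [G0] at the start of the phase: [cluster] is
   frozen, so that [out] is nondecreasing along the process. *)
Definition core : {set 'I_n} := u |: nbr G0 u.
Definition tied : {set 'I_n} :=
  [set w | (w \notin core) && (d <= 4 * #|nbr G0 w :&: core|)%N].
Definition cluster : {set 'I_n} := core :|: tied.
Definition out G x : nat := #|nbr G x :\: cluster|.
(** [k = 4] delimits [body], while the weaker threshold d/8 ([k = 8]) decides the case of a round.
    The factor 2 between them gives the room needed in [spread_ge]. *)
Definition heavy k G : {set 'I_n} := [set x in cluster | (d <= k * out G x)%N].
Definition body G : {set 'I_n} := cluster :\: heavy 4 G.
Definition cut_size G : nat := (\sum_(x in body G) #|nbr G x :\: body G|)%N.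
Definition fresh G x : {set 'I_n} := ~: (body G :|: nbr G x).
Definition stalled G : bool := (32 * deg G u < 33 * d)%N.
Definition gain G : R := \sum_(w in ~: (u |: nbr G u)) step_prob G u w.

Hypotheses (n1 : (1 < n)%N) (gG0 : good_graph G0).
Hypothesis deg_d : forall x, (d <= deg G0 x)%N.
Hypothesis d_gt0 : (0 < d)%N.
Hypothesis d_small : (3 * d + 2 <= 2 * n)%N.

Definition later G := good_graph G /\ G0 \subset G.

Lemma later_deg G x : later G -> (d <= deg G x)%N.
Proof. by case=> _ sG; apply: leq_trans (deg_d x) (subset_leq_card (nbr_sub x sG)). Qed.

Lemma later_next G c : later G -> later (next_graph G c).
Proof. by case=> gG sG; split; [apply: next_good|apply: subset_trans (next_sub _ _)]. Qed.

Lemma body_in G x : (x \in body G) = (x \in cluster) && (4 * out G x < d)%N.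
Proof. by rewrite !inE ltnNge; case: (_ || _); rewrite ?andbF ?andbT. Qed.

Lemma core_in x : (x \in core) = (x == u) || (x \in nbr G0 u).
Proof. by rewrite !inE. Qed.

Lemma tied_in w : (w \in tied) =
  [&& w != u, w \notin nbr G0 u & (d <= 4 * #|nbr G0 w :&: core|)%N].
Proof. by rewrite !inE negb_or -andbA. Qed.

Lemma cluster_in x :
  (x \in cluster) = [|| x == u, x \in nbr G0 u | x \in tied].
Proof. by rewrite in_setU core_in -orbA. Qed.

Lemma u_cluster : u \in cluster.
Proof. by rewrite cluster_in eqxx. Qed.

Lemma new_nbrs G : later G -> stalled G -> (32 * #|nbr G u :\: nbr G0 u| < d)%N.
Proof.
move=> [gG sG]; rewrite /stalled => st.
have := cardsID (nbr G0 u) (nbr G u); rewrite (setIidPr (nbr_sub u sG)).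
have := deg_d u; rewrite /deg in st *; lia.
Qed.

Lemma card_core G : later G -> stalled G -> (32 * #|core| < 33 * d + 32)%N.
Proof.
move=> [gG sG]; rewrite /stalled => st.
have := subset_leq_card (nbr_sub u sG); rewrite /deg in st *.
rewrite cardsU1 nbr_irr; last by case: gG0.
lia.
Qed.

(** The cluster has fewer than 35d/32 + 1 vertices, and 3d + 2 <= 2n keeps this below n. *)
Lemma card_cluster G : later G -> stalled G -> (16 * #|tied| < d)%N ->
  (#|cluster| < n)%N /\ (#|cluster| <= 3 * d)%N.
Proof.
move=> lG st td; have := card_core lG st.
have := leq_card_setU (subxx cluster).
by split; lia.
Qed.

Lemma gainE G : later G ->
  gain G = (deg G u)%:R^-1 *
    \sum_(v in nbr G u) (deg G v)%:R^-1 * #|nbr G v :&: ~: (u |: nbr G u)|%:R.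
Proof. by move=> [gG _]; rewrite /gain step_set ?deg_gt0 // mulr_sumr. Qed.

(** Fewer than d/32 tied vertices have become adjacent to [u], so at least d/32 are still targets.
    Each shares d/4 neighbours with [u], as its neighbours in [core] differ from [u]. These d^2/128
    walks have probability at least 1/(n deg u) each, with deg u < 33d/32. *)
Lemma gain_tied G : later G -> stalled G -> (d <= 16 * #|tied|)%N ->
  d%:R / (900 * n%:R) <= gain G.
Proof.
move=> lG st td; have [[sG cG] sub] := lG.
have dG := later_deg u lG.
pose S := tied :\: nbr G u.
have cS : (d <= 32 * #|S|)%N.
  have := new_nbrs lG st.
  have := cardsID (nbr G u) tied.
  have : (#|tied :&: nbr G u| <= #|nbr G u :\: nbr G0 u|)%N.
    apply: subset_leq_card; apply/subsetP => w.
    rewrite in_setI in_setD => /andP[+ ->]; rewrite andbT.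
    by rewrite tied_in => /and3P[].
  rewrite /S; lia.
have dc : (d * d <= 128 * \sum_(v in nbr G u) #|nbr G v :&: S|)%N.
  rewrite sum_nbr_swap //.
  have : (\sum_(w in S) d <= \sum_(w in S) 4 * #|nbr G w :&: nbr G u|)%N.
    apply: leq_sum => w; rewrite in_setD => /andP[_].
    rewrite tied_in => /and3P[wu wN /leq_trans->] //.
    rewrite leq_mul2l /=; apply: subset_leq_card; apply/subsetP => z.
    rewrite !in_setI core_in => /andP[zw /orP[/eqP zu|zu]].
      by rewrite -zu nbr_sym in wN; [rewrite zw in wN|case: gG0].
    by rewrite (subsetP (nbr_sub _ sub)) // (subsetP (nbr_sub _ sub)).
  rewrite sum_nat_const -big_distrr /= => h.
  have := leq_mul cS (leqnn d); rewrite -mulnA => /leq_trans-> //.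
  by rewrite -[128%N]/(32 * 4)%N -mulnA leq_mul2l.
have le : n%:R^-1 * (\sum_(v in nbr G u) #|nbr G v :&: S|)%N%:R <=
    \sum_(v in nbr G u) (deg G v)%:R^-1 * #|nbr G v :&: ~: (u |: nbr G u)|%:R :> R.
  rewrite natr_sum mulr_sumr; apply: ler_sum => v uv.
  have d0 := deg_gt0 v n1 (conj sG cG); have dn := ltnW (deg_ltn v sG).
  apply: ler_pM; rewrite ?invr_ge0 ?ler0n //.
    by rewrite lef_pV2 ?ler_nat // posrE ltr0n //; lia.
  rewrite ler_nat; apply: subset_leq_card; apply: setIS; apply/subsetP => w.
  rewrite in_setD tied_in => /and4P[wN wu _ _].
  by rewrite in_setC in_setU1 negb_or wu.
rewrite gainE //; apply: le_trans (ler_wpM2l _ le); last by rewrite invr_ge0.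
move: dc st dG; rewrite /stalled.
move: (\sum_(_ in _) _)%N (deg G u) => s q dc st dG.
have q0 : 0 < q%:R :> R by rewrite ltr0n; lia.
have n0 : 0 < n%:R :> R by rewrite ltr0n; lia.
have D0 : 0 < d%:R :> R by rewrite ltr0n.
have dcR : d%:R * d%:R <= 128 * s%:R :> R by move: dc; rewrite -(ler_nat R) !natrM.
have stR : 32 * q%:R <= 33 * d%:R :> R by move/ltnW: st; rewrite -(ler_nat R) !natrM.
have -> : q%:R^-1 * (n%:R^-1 * s%:R) = (s%:R / q%:R) / n%:R :> R by field; rewrite !gt_eqF.
rewrite invfM mulrA ler_wpM2r ?invr_ge0 ?(ltW n0) //.
have := ler_wpM2l (ltW D0) stR.
by rewrite ler_pdivlMr //; nra.
Qed.

Lemma u_light G : later G -> stalled G -> (8 * out G u < d)%N.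
Proof.
move=> lG st; have := new_nbrs lG st.
have : (out G u <= #|nbr G u :\: nbr G0 u|)%N.
  apply: subset_leq_card; apply: setDS; apply/subsetP => w wN.
  by rewrite cluster_in wN orbT.
lia.
Qed.

Lemma deg_cluster G x : (deg G x <= #|cluster| + out G x)%N.
Proof.
apply: leq_card_setU; apply/subsetP => w xw.
by rewrite in_setU in_setD xw andbT orbN.
Qed.

(** Of more than d/8 heavy vertices, fewer than d/16 are tied and [u] is not heavy, so at least d/16
    are neighbours of [u]. From each, the second step is new with probability at least 1/50, since
    fewer than d/32 of its outside neighbours are already adjacent to [u]. As 16 * 50 * 33/32 = 825,
    the constant 900 suffices. *)
Lemma gain_heavy G : later G -> stalled G -> (16 * #|tied| < d)%N ->
  (d < 8 * #|heavy 8 G|)%N -> d%:R / (900 * n%:R) <= gain G.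
Proof.
move=> lG st td hv; have [[sG cG] sub] := lG.
have dG := later_deg u lG.
have [_ cA] := card_cluster lG st td.
have ul := u_light lG st.
pose S := heavy 8 G :&: nbr G u.
have cS : (d <= 16 * #|S|)%N.
  have : (#|heavy 8 G| <= #|S| + #|tied|)%N.
    apply: leq_card_setU; apply/subsetP => x xH; rewrite in_setU in_setI xH /=.
    move: xH; rewrite inE cluster_in => /andP[/or3P[/eqP->|xN|->]]; last by rewrite orbT.
      by lia.
    by rewrite (subsetP (nbr_sub _ sub)).
  lia.
rewrite gainE //.
have le : #|S|%:R / 50 <=
    \sum_(v in nbr G u) (deg G v)%:R^-1 * #|nbr G v :&: ~: (u |: nbr G u)|%:R :> R.
  rewrite [X in _ <= X](bigID (mem S)) /=.
  apply: ler_wpDr; first by apply: sumr_ge0 => v _; rewrite mulr_ge0 // invr_ge0.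
  rewrite -sum1_card natr_sum mulr_suml.
  rewrite [X in _ <= X](eq_bigl (mem S)); last first.
    by move=> v /=; rewrite /S in_setI andbC -andbA andbb.
  apply: ler_sum => v; rewrite in_setI inE => /andP[/andP[vA vh] uv].
  have d0 := deg_gt0 v n1 (conj sG cG).
  have dv := deg_cluster G v.
  have nn := new_nbrs lG st.
  have : (out G v <= #|nbr G v :&: ~: (u |: nbr G u)| + #|nbr G u :\: nbr G0 u|)%N.
    apply: leq_card_setU; apply/subsetP => w.
    rewrite in_setD cluster_in !negb_or => /andP[/and3P[wu wN _] vw].
    rewrite in_setU in_setI vw in_setC in_setU1 negb_or wu in_setD wN /=.
    by rewrite orNb.
  move: (#|nbr G v :&: _|) => s sv.
  by rewrite mul1r ler_pdivlMl ?ltr0n // ler_pdivrMr // -natrM ler_nat; lia.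
apply: le_trans (ler_wpM2l _ le); last by rewrite invr_ge0.
move: st dG; rewrite /stalled; move: (deg G u) => q st dG.
have q0 : 0 < q%:R :> R by rewrite ltr0n; lia.
have n0 : 0 < n%:R :> R by rewrite ltr0n; lia.
have D0 : 0 < d%:R :> R by rewrite ltr0n.
have dnR : d%:R <= n%:R :> R by rewrite ler_nat; lia.
have sR : d%:R <= 16 * #|S|%:R :> R by move: cS; rewrite -(ler_nat R) !natrM.
have stR : 32 * q%:R <= 33 * d%:R :> R by move/ltnW: st; rewrite -(ler_nat R) !natrM.
apply: (@le_trans _ _ 900^-1).
  by rewrite ler_pdivrMr ?mulr_gt0 //; lra.
by rewrite ler_pdivlMl //; lra.
Qed.

(** * The cut around the body: positivity and the rate of new cut edges *)

Lemma u_body G : later G -> stalled G -> u \in body G.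
Proof. by move=> lG st; rewrite body_in u_cluster /=; have := u_light lG st; lia. Qed.

Lemma cut_sizeE G : simple_undirected G ->
  cut_size G = (\sum_(w in ~: body G) #|nbr G w :&: body G|)%N.
Proof.
by move=> sG; rewrite -sum_nbr_swap //; apply: eq_bigr => x _; rewrite setDE.
Qed.

(** With an empty cut the body would be closed under adjacency and, by connectivity from [u],
    contain every vertex, but the cluster has fewer than n. *)
Lemma cut_gt0 G : later G -> stalled G -> (16 * #|tied| < d)%N -> (0 < cut_size G)%N.
Proof.
move=> lG st td; have [cn _] := card_cluster lG st td; have [[sG cG] _] := lG.
rewrite lt0n sum_nat_eq0; apply/negP => /forallP c0.
have cl : closed (adj G) (body G).
  have half x y : adj G x y -> x \in body G -> y \in body G.
    move=> xy xB; have := c0 x; rewrite xB /= cards_eq0 => /eqP/setP/(_ y).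
    by rewrite in_setD in_set0 nbrP [_ \in G]xy andbT => /negbFE.
  move=> x y xy; apply/idP/idP; first exact: half.
  by apply: half; case: sG => + _; apply.
have /subset_leq_card : [set: 'I_n] \subset cluster.
  apply/subsetP => z _; have := closed_connect cl (cG u z).
  by rewrite u_body // => /esym; rewrite body_in => /andP[].
by rewrite cardsT card_ord; lia.
Qed.

Lemma heavy_sub G : heavy 4 G \subset heavy 8 G.
Proof.
by apply/subsetP => x; rewrite !inE => /andP[-> h] /=; apply: leq_trans h _; rewrite leq_mul2r orbT.
Qed.

Lemma deg_split G x :
  (deg G x <= #|nbr G x :&: body G| + out G x + #|heavy 4 G|)%N.
Proof.
rewrite -addnA; apply: (leq_trans (n := (#|nbr G x :&: body G| +
    #|(nbr G x :\: cluster) :|: heavy 4 G|)%N)); last first.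
  by rewrite leq_add2l; apply: leq_card_setU.
apply: leq_card_setU; apply/subsetP => w xw.
rewrite 2!in_setU in_setI in_setD xw /= andbT in_setD.
by case: (w \in cluster); rewrite ?orbT //= andbT orNb.
Qed.

Lemma out_body G x : (#|nbr G x :\: body G| <= out G x + #|heavy 4 G|)%N.
Proof.
apply: leq_card_setU; apply/subsetP => w.
rewrite in_setU in_setD => /andP[+ xw]; rewrite in_setD in_setD xw andbT.
by case: (w \in cluster); rewrite ?orbT //= andbT negbK.
Qed.

(** Count the walks x - v - w by [w]. Each neighbour [v] of [w] in the body has more than d - d/4 -
    d/8 body neighbours, and fewer than d/4 of these are adjacent to [w], which leaves at least 3d/8
    choices of [x]. *)
Lemma two_body_steps G : later G -> (8 * #|heavy 8 G| <= d)%N ->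
  (3 * d * \sum_(w in ~: body G | 4 * #|nbr G w :&: body G| < d) #|nbr G w :&: body G|
   <= 8 * \sum_(x in body G) \sum_(v in nbr G x :&: body G) #|nbr G v :&: fresh G x|)%N.
Proof.
move=> lG hv; have [[sG cG] sub] := lG.
have h4 : (#|heavy 4 G| <= #|heavy 8 G|)%N by apply: subset_leq_card (heavy_sub G).
pose I x v w : nat := [&& x \in body G, v \in body G, v \in nbr G x,
  w \in nbr G v, w \notin body G & w \notin nbr G x].
have -> : (\sum_(x in body G) \sum_(v in nbr G x :&: body G) #|nbr G v :&: fresh G x| =
    \sum_w \sum_v \sum_x I x v w)%N.
  rewrite [RHS]exchange_big /= [RHS](eq_bigr (fun v => \sum_x \sum_w I x v w)%N); last first.
    by move=> v _; rewrite exchange_big.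
  rewrite [RHS]exchange_big /= big_mkcond; apply: eq_bigr => x _.
  case: ifP => xB; last by rewrite big1 // => v _; rewrite big1 // => w _; rewrite /I xB.
  rewrite big_mkcond; apply: eq_bigr => v _; rewrite in_setI.
  case: (boolP (v \in nbr G x)) => vx; last by rewrite big1 // => w _; rewrite /I (negbTE vx) !andbF.
  case: (boolP (v \in body G)) => vB; last by rewrite big1 // => w _; rewrite /I (negbTE vB) !andbF.
  rewrite -sum1_card big_mkcond; apply: eq_bigr => w _.
  by rewrite /I xB vB vx in_setI in_setC in_setU negb_or; case: ifP.
rewrite !big_distrr /= big_mkcond; apply: leq_sum => w _.
case: ifP => //; rewrite in_setC => /andP[wB kw].
have -> : (\sum_v \sum_x I x v w =
    \sum_(v in nbr G w :&: body G) #|(nbr G v :&: body G) :\: nbr G w|)%N.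
  rewrite [RHS]big_mkcond; apply: eq_bigr => v _; rewrite in_setI.
  case: (boolP (v \in nbr G w)) => vw; last first.
    by rewrite big1 // => x _; rewrite /I (nbr_sym v w sG) (negbTE vw) !andbF.
  case: (boolP (v \in body G)) => vB; last by rewrite big1 // => x _; rewrite /I (negbTE vB) !andbF.
  rewrite -sum1_card [RHS]big_mkcond; apply: eq_bigr => x _.
  rewrite /I vB wB (nbr_sym v w sG) vw in_setD in_setI (nbr_sym x v sG) (nbr_sym x w sG) /=.
  by case: (x \in body G); case: (x \in nbr G v); case: (x \in nbr G w).
rewrite mulnC -sum_nat_const big_distrr /=; apply: leq_sum => y.
rewrite in_setI => /andP[yw]; rewrite body_in => /andP[_ oy].
have dy := leq_trans (later_deg y lG) (deg_split G y).
have : (#|nbr G y :&: body G| <= #|(nbr G y :&: body G) :\: nbr G w| + #|nbr G w :&: body G|)%N.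
  apply: leq_card_setU; apply/subsetP => z.
  by rewrite in_setI => /andP[zy zB]; rewrite in_setU in_setD !in_setI zy zB /= !andbT orNb.
move: h4 hv kw oy dy; move: #|heavy 4 G| #|heavy 8 G| (out G y) #|nbr G y :&: body G| #|nbr G w :&: body G| #|_ :\: _|.
clear; move=> a b o e f g. lia.
Qed.

(* Outside the cluster this is why [tied] is absorbed: a vertex that is not tied
   has most of its initial neighbours outside the cluster. *)
Lemma out_ge G w : later G -> (16 * #|tied| < d)%N -> w \notin body G ->
  (d <= 4 * out G w)%N.
Proof.
move=> [gG sub] td; rewrite body_in negb_and -leqNgt => /orP[|//].
rewrite cluster_in !negb_or tied_in => /and3P[-> -> /=]; rewrite -ltnNge => kw.
have : (deg G0 w <= #|nbr G0 w :&: core| + (#|tied| + out G w))%N.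
  apply: (leq_trans (n := (#|nbr G0 w :&: core| + #|tied :|: (nbr G w :\: cluster)|)%N)); last first.
    by rewrite leq_add2l; apply: leq_card_setU.
  apply: leq_card_setU; apply/subsetP => z zw.
  rewrite 2!in_setU in_setI zw in_setD (subsetP (nbr_sub w sub)) // andbT [z \in cluster]in_setU /=.
  by case: (z \in core); case: (z \in tied).
move: kw td (deg_d w).
by move: #|nbr G0 w :&: core| #|tied| (out G w) (deg G0 w) => a t o q; lia.
Qed.

(** Walks are split by whether their midpoint is in the body, and cut edges by whether their outer
    endpoint has fewer than d/4 body neighbours. Body degrees are at most 4d, and 208 = 4 * 52. *)
Lemma spread_ge G : later G -> stalled G -> (16 * #|tied| < d)%N ->
  (8 * #|heavy 8 G| <= d)%N ->
  (cut_size G)%:R / (208 * d%:R) <=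
  \sum_(x in body G) \sum_(w in fresh G x) step_prob G x w.
Proof.
move=> lG st td hv; have [[sG cG] sub] := lG.
have [_ cA] := card_cluster lG st td.
have D0 : 0 < d%:R :> R by rewrite ltr0n.
have degB x : x \in body G -> (deg G x <= 4 * d)%N.
  by rewrite body_in => /andP[_ ox]; have := deg_cluster G x; lia.
have deg0 x : (0 < deg G x)%N := deg_gt0 x n1 (conj sG cG).
have invB x : x \in body G -> (4 * d%:R)^-1 <= (deg G x)%:R^-1 :> R.
  move=> /degB h; rewrite lef_pV2 ?posrE ?mulr_gt0 ?ltr0n ?deg0 //.
  by rewrite -natrM ler_nat.
pose r x v : R := (deg G v)%:R^-1 * #|nbr G v :&: fresh G x|%:R.
have r0 x v : 0 <= r x v by rewrite mulr_ge0 ?invr_ge0.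
pose K1 := (\sum_(w in ~: body G | 4 * #|nbr G w :&: body G| < d) #|nbr G w :&: body G|)%N.
pose K2 := (\sum_(w in ~: body G | d <= 4 * #|nbr G w :&: body G|) #|nbr G w :&: body G|)%N.
have cutE : cut_size G = (K1 + K2)%N.
  rewrite cut_sizeE // (bigID (fun w => 4 * #|nbr G w :&: body G| < d)%N) /=; congr (_ + _)%N.
  by apply: eq_bigl => w; rewrite -leqNgt.
(* 3/32 is 3d/8 from [two_body_steps] divided by the degree bound 4d. *)
have part1 : 3 / 32 * K1%:R <= \sum_(x in body G) \sum_(v in nbr G x :&: body G) r x v.
  have := two_body_steps lG hv; rewrite -/K1.
  set N1 := (\sum_(x in _) _)%N => h.
  apply: (@le_trans _ _ ((4 * d%:R)^-1 * N1%:R)).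
    rewrite ler_pdivlMl ?mulr_gt0 //.
    by move: h; rewrite -(ler_nat R) !natrM; lra.
  rewrite /N1 natr_sum mulr_sumr; apply: ler_sum => x xB.
  rewrite natr_sum mulr_sumr; apply: ler_sum => v; rewrite in_setI => /andP[_ vB].
  by rewrite ler_wpM2r // invB.
have part2 : 1 / 52 * K2%:R <= \sum_(x in body G) \sum_(w in nbr G x :\: body G) r x w.
  rewrite (exchange_big_dep (fun w => w \in ~: body G)) /=; last first.
    by move=> x w _; rewrite in_setD in_setC => /andP[].
  rewrite /K2 natr_sum mulr_sumr big_mkcondr /=; apply: ler_sum => w; rewrite in_setC => wB.
  case: ifP => kw; last by apply: sumr_ge0.
  pose Z := (nbr G w :&: body G) :\: heavy 8 G.
  have cZ : (#|nbr G w :&: body G| <= 2 * #|Z|)%N.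
    have : (#|nbr G w :&: body G| <= #|Z| + #|heavy 8 G|)%N.
      apply: leq_card_setU; apply/subsetP => z zz.
      by rewrite in_setU in_setD zz andbT orNb.
    move: kw hv; move: #|nbr G w :&: body G| #|heavy 8 G| #|Z|; clear => a b e; lia.
  (* 1/26 is (d/8) / (3d + d/4), the worst case [out G w = d/4]. At least half of the body
     neighbours of [w] lie in [Z], whence 1/52. *)
  apply: (@le_trans _ _ (\sum_(x in Z) 26^-1)).
    rewrite sumr_const -mulr_natl; move: cZ; rewrite -(ler_nat R) natrM; lra.
  rewrite big_mkcond [X in _ <= X]big_mkcond; apply: ler_sum => x _.
  case: ifP => [|_]; last by case: ifP.
  rewrite in_setD in_setI => /andP[xh /andP[xw xB]].
  rewrite xB in_setD wB (nbr_sym x w sG) xw /=.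
  have ow := out_ge lG td wB.
  have dw := deg_cluster G w.
  have ox : (8 * out G x < d)%N.
    by move: xh xB; rewrite inE negb_and body_in -ltnNge => /orP[/negbTE->//|].
  have : (out G w <= #|nbr G w :&: fresh G x| + out G x)%N.
    apply: leq_card_setU; apply/subsetP => z; rewrite in_setD => /andP[zA zw].
    rewrite in_setU in_setI zw in_setC in_setU negb_or in_setD zA /=.
    have -> : z \notin body G by rewrite body_in (negbTE zA).
    by rewrite orNb.
  move=> h; rewrite /r ler_pdivlMl ?ltr0n // ler_pdivrMr // -natrM ler_nat; lia.
apply: (@le_trans _ _ ((4 * d%:R)^-1 *
    \sum_(x in body G) \sum_(v in nbr G x) r x v)); last first.
  rewrite mulr_sumr; apply: ler_sum => x xB; rewrite step_set // -mulr_sumr.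
  by apply: ler_wpM2r (invB _ xB); apply: sumr_ge0.
have -> : \sum_(x in body G) \sum_(v in nbr G x) r x v =
    \sum_(x in body G) \sum_(v in nbr G x :&: body G) r x v +
    \sum_(x in body G) \sum_(w in nbr G x :\: body G) r x w.
  rewrite -big_split; apply: eq_bigr => x _.
  by rewrite (big_setID (body G)).
rewrite ler_pdivlMl ?mulr_gt0 // cutE natrD.
have -> : 4 * d%:R * ((K1%:R + K2%:R) / (208 * d%:R)) = (K1%:R + K2%:R) / 52 :> R.
  by field; rewrite gt_eqF.
have : 0 <= K1%:R :> R by [].
lra.
Qed.

(* Without the cap, the cut could shrink once too many vertices are heavy; the
   successor keeps the denominator of [potential] nonzero. *)
Definition capped_cut G : nat :=
  if (d < 8 * #|heavy 4 G|)%N then (2 * n * n)%N else (cut_size G).+1.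
Definition potential G : R :=
  if stalled G then (3 * d%:R - (deg G u)%:R) / (capped_cut G)%:R else 0.
Definition new_links G (c : {ffun 'I_n -> 'I_n}) : {set 'I_n} :=
  [set x in body G | c x \in fresh G x].

(** * Monotonicity of the capped cut and expected decay of the potential *)

Lemma out_next G c x : (out G x <= out (next_graph G c) x)%N.
Proof. by apply: subset_leq_card; apply/setSD/nbr_sub/next_sub. Qed.

Lemma heavy_next k G c : heavy k G \subset heavy k (next_graph G c).
Proof.
apply/subsetP => x; rewrite !inE => /andP[-> h] /=.
by apply: leq_trans h _; rewrite leq_mul2l out_next orbT.
Qed.

Lemma deg_next G c x : (deg G x <= deg (next_graph G c) x)%N.
Proof. by apply: subset_leq_card; apply/nbr_sub/next_sub. Qed.

(** Makes the cap high enough: replacing the cut by 2n^2 is an increase even after the new links are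
    added. *)
Lemma cut_links_le G c : later G ->
  (cut_size G + #|new_links G c| < 2 * n * n)%N.
Proof.
move=> [[sG cG] _].
have cB : (#|body G| <= n)%N by rewrite -[X in (_ <= X)%N]card_ord; apply: max_card.
have l1 : (#|new_links G c| <= #|body G|)%N.
  by apply: subset_leq_card; apply/subsetP => x; rewrite inE => /andP[].
have l2 : (cut_size G <= \sum_(x in body G) n.-1)%N.
  apply: leq_sum => x _; have := deg_ltn x sG.
  have : (#|nbr G x :\: body G| <= deg G x)%N by apply: subset_leq_card; apply: subsetDl.
  by move=> h1 h2; rewrite -ltnS (ltn_predK n1); apply: leq_ltn_trans h1 h2.
rewrite sum_nat_const in l2.
move: n1 l1 l2 cB; move: #|new_links G c| #|body G| (cut_size G) => a b e.
by clear; case: n => // m _ /=; nia.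
Qed.

(* A vertex that leaves the body had fewer than [d/4 + d/8] cut edges, and all of
   its edges to the remaining body, more than [d/2] of them, become cut edges. *)
Lemma cut_next G c : later G -> (8 * #|heavy 4 (next_graph G c)| <= d)%N ->
  (cut_size G + #|new_links G c| <= cut_size (next_graph G c))%N.
Proof.
move=> lG hv; have lG' := later_next c lG; have [[sG cG] _] := lG.
set G' := next_graph G c in hv lG' *.
have hle : (#|heavy 4 G| <= #|heavy 4 G'|)%N by apply/subset_leq_card/heavy_next.
have BB x : x \in body G' -> x \in body G.
  by rewrite !body_in => /andP[-> h]; apply: leq_ltn_trans h; rewrite leq_mul2l out_next orbT.
pose Rm := body G :\: body G'.
(* A vertex staying in the body keeps its cut edges, gains its edges to the leaving vertices [Rm],
   and gains its new link. *)
have keep x : x \in body G' -> (#|nbr G x :\: body G| + #|nbr G x :&: Rm| +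
    (x \in new_links G c) <= #|nbr G' x :\: body G'|)%N.
  move=> xB'; have xB := BB _ xB'.
  apply: (leq_trans (n := (#|nbr G x :\: body G'| + (x \in new_links G c))%N)).
    rewrite leq_add2r; apply: leq_card_disjoint.
    - by apply: setDS; apply/subsetP => z; apply: BB.
    - by apply/subsetP => z; rewrite in_setI !in_setD => /and3P[-> -> _].
    - rewrite -setI_eq0; apply/eqP/setP => z; rewrite in_setI in_setD in_setI [z \in Rm]in_setD in_set0.
      by case: (z \in body G); rewrite ?andbF.
  have sN : nbr G x :\: body G' \subset nbr G' x :\: body G' by apply/setSD/nbr_sub/next_sub.
  case: (boolP (x \in new_links G c)) => [|_]; last by rewrite addn0 subset_leq_card.
  rewrite inE xB in_setC in_setU negb_or /= => /andP[cB cN].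
  rewrite -(cards1 (c x)); apply: leq_card_disjoint => //.
    rewrite sub1set in_setD nbrP nextP eqxx orTb andbT.
    rewrite (contra (BB _) cB) /= (contraNneq _ cB) ?orbT // => <- //.
  rewrite -setI_eq0; apply/eqP/setP => z; rewrite in_setI in_setD in_set1 in_set0.
  by apply/negP => /andP[/andP[_ zN] /eqP zc]; rewrite -zc zN in cN.
(* The extra 1 pays for the link that [y] itself may have made, which [keep] does not count. *)
have lost y : y \in Rm -> (#|nbr G y :\: body G| + 1 <= #|nbr G y :&: body G'|)%N.
  rewrite in_setD => /andP[yB' yB].
  have ob := out_body G y.
  have oy : (4 * out G y < d)%N by move: yB; rewrite body_in => /andP[].
  have dy := later_deg y lG.
  have : (deg G y <= #|nbr G y :&: body G'| + (out G y + #|heavy 4 G'|))%N.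
    apply: (leq_trans (n := (#|nbr G y :&: body G'| +
      #|(nbr G y :\: cluster) :|: heavy 4 G'|)%N)); last first.
      by rewrite leq_add2l; apply: leq_card_setU.
    apply: leq_card_setU; apply/subsetP => w yw.
    rewrite 2!in_setU in_setI in_setD yw /= andbT in_setD.
    by case: (w \in cluster); rewrite ?orbT //= andbT orNb.
  move: ob oy dy hle hv.
  move: (out G y) #|heavy 4 G| #|heavy 4 G'| (deg G y) #|nbr G y :&: body G'| #|nbr G y :\: body G|.
  by clear; move=> a b e f g h; lia.
have swp : (\sum_(x in body G') #|nbr G x :&: Rm| = \sum_(y in Rm) #|nbr G y :&: body G'|)%N.
  exact: sum_nbr_swap.
have lnk : (#|new_links G c| <= \sum_(x in body G') (x \in new_links G c) + #|Rm|)%N.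
  have -> : (\sum_(x in body G') (x \in new_links G c) = #|new_links G c :&: body G'|)%N.
    rewrite -sum1_card [RHS](eq_bigl (fun x => (x \in body G') && (x \in new_links G c))).
      by rewrite [RHS]big_mkcondr; apply: eq_bigr => x _; case: ifP.
    by move=> x; rewrite in_setI andbC.
  apply: leq_card_setU; apply/subsetP => x xL; rewrite in_setU in_setI xL [x \in Rm]in_setD /=.
  by move: xL; rewrite inE => /andP[-> _]; rewrite andbT orbN.
have cutE : (cut_size G = \sum_(x in body G') #|nbr G x :\: body G| +
    \sum_(y in Rm) #|nbr G y :\: body G|)%N.
  rewrite /cut_size (big_setID (body G')) /= (setIidPr _) //.
  by apply/subsetP => x; apply: BB.
have s1 : (\sum_(x in body G') (#|nbr G x :\: body G| + #|nbr G x :&: Rm| +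
    (x \in new_links G c)) <= cut_size G')%N by apply: leq_sum => x; apply: keep.
have s2 : (\sum_(y in Rm) (#|nbr G y :\: body G| + 1) <=
    \sum_(y in Rm) #|nbr G y :&: body G'|)%N by apply: leq_sum => y; apply: lost.
move: s1 s2 lnk; rewrite !big_split /= sum1_card swp cutE.
move: #|new_links G c| (\sum_(i in Rm) #|_ :\: _|)%N (\sum_(i in Rm) #|_ :&: _|)%N #|Rm| (cut_size G').
move: (\sum_(i in body G') #|_|)%N (\sum_(i in body G') (i \in _))%N.
by clear; move=> a b e f g h k; lia.
Qed.

(** Heavy sets only grow, so the cap is never left once reached; before that, [cut_next] applies,
    and [cut_links_le] covers the moment of capping. *)
Lemma capped_cut_next G c : later G ->
  (capped_cut G + (if (d < 8 * #|heavy 4 G|)%N then 0 else #|new_links G c|)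
   <= capped_cut (next_graph G c))%N.
Proof.
move=> lG; rewrite /capped_cut.
have hle : (#|heavy 4 G| <= #|heavy 4 (next_graph G c)|)%N by apply/subset_leq_card/heavy_next.
case: ifP => h.
  by rewrite ifT ?addn0 //; apply: leq_trans h _; rewrite leq_mul2l.
case: ifPn => h'; first by rewrite addSn; apply: cut_links_le.
by rewrite addSn ltnS cut_next // leqNgt.
Qed.

Lemma deg_next_gain G c : c u \in ~: (u |: nbr G u) ->
  (deg G u < deg (next_graph G c) u)%N.
Proof.
rewrite in_setC in_setU1 negb_or => /andP[cu cN].
have := subset_leq_card (_ : c u |: nbr G u \subset nbr (next_graph G c) u).
rewrite cardsU1 cN; apply; apply/subsetP => w; rewrite in_setU1 => /orP[/eqP->|].
  by rewrite nbrP nextP eqxx eq_sym cu orbT.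
exact/subsetP/nbr_sub/next_sub.
Qed.

Lemma capped_cut_gt0 G : (0 < capped_cut G)%N.
Proof. by rewrite /capped_cut; case: ifP => // _; have := n1; lia. Qed.

Lemma stalled_next G c : stalled (next_graph G c) -> stalled G.
Proof.
by rewrite /stalled; apply: leq_ltn_trans; rewrite leq_mul2l deg_next orbT.
Qed.

Lemma stalled_room G : stalled G -> (deg G u)%:R + 1 <= 3 * d%:R :> R.
Proof.
rewrite /stalled => st; have h : (deg G u + 1 <= 3 * d)%N by have := d_gt0; lia.
by move: h; rewrite -(ler_nat R) natrD natrM.
Qed.

Lemma potential_next G c : later G -> stalled G ->
  potential (next_graph G c) <=
  (3 * d%:R - (deg G u)%:R - (c u \in ~: (u |: nbr G u))%:R) / (capped_cut G)%:R.
Proof.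
move=> lG st; have rm := stalled_room st.
have C0 : 0 < (capped_cut G)%:R :> R by rewrite ltr0n capped_cut_gt0.
have CC : (capped_cut G)%:R <= (capped_cut (next_graph G c))%:R :> R.
  by rewrite ler_nat; apply: leq_trans (capped_cut_next c lG); apply: leq_addr.
rewrite /potential; case: ifP => [st'|_]; last first.
  by apply: divr_ge0; [case: (_ \in _) => /=; lra|exact: ltW].
have rm' := stalled_room st'.
apply: ler_pM; rewrite ?invr_ge0 //; first by lra.
  rewrite -addrA -opprD lerD2l lerN2 -natrD ler_nat.
  case: (boolP (_ \in _)) => [/deg_next_gain|_]; first by rewrite addn1.
  by rewrite addn0 deg_next.
by rewrite lef_pV2 ?posrE // (lt_le_trans C0).
Qed.

(** The numerator is at most 3d and loses d/(900n) in expectation, a relative loss of 1/(2700n); the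
    denominator never decreases. *)
Lemma potential_decay_gain G : later G -> stalled G ->
  d%:R / (900 * n%:R) <= gain G ->
  round_exp potential G <= (1 - (2700 * n%:R)^-1) * potential G.
Proof.
move=> lG st hg; have [gG _] := lG; have rm := stalled_room st.
have C0 : 0 < (capped_cut G)%:R :> R by rewrite ltr0n capped_cut_gt0.
have n0 : 0 < n%:R :> R by rewrite ltr0n; have := n1; lia.
pose K : R := 3 * d%:R - (deg G u)%:R.
pose f w : R := (K - (w \in ~: (u |: nbr G u))%:R) / (capped_cut G)%:R.
apply: (@le_trans _ _ (\sum_c choice_weight G c * f (c u))).
  by apply: ler_sum => c _; rewrite ler_wpM2l ?choice_weight_ge0 // potential_next.
rewrite choice_marginal //.
have -> : \sum_w step_prob G u w * f w = (K - gain G) / (capped_cut G)%:R.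
  under eq_bigr => w _ do rewrite /f mulrA mulrBr.
  rewrite -mulr_suml; congr (_ / _).
  rewrite big_split /= -mulr_suml step_sum1 // mul1r; congr (_ + _).
  rewrite sumrN; congr (- _); rewrite /gain [RHS]big_mkcond.
  by apply: eq_bigr => w _; case: ifP; rewrite ?mulr1 ?mulr0.
rewrite /potential st mulrA ler_wpM2r ?invr_ge0 ?(ltW C0) // mulrBl mul1r lerD2l lerN2.
apply: le_trans hg; rewrite mulrC ler_pdivrMr ?mulr_gt0 //.
have -> : d%:R / (900 * n%:R) * (2700 * n%:R) = 3 * d%:R :> R.
  by field; rewrite gt_eqF.
by rewrite gerBl.
Qed.

(** [ratio_le_power] replaces [N / (N + k)] by a product over vertices, whose expectation
    factorizes; [prod_le_inv_sum] then turns the expected number of new cut edges into a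
    decrease. *)
Lemma potential_decay_spread G : later G -> stalled G ->
  (16 * #|tied| < d)%N -> (8 * #|heavy 8 G| <= d)%N ->
  round_exp potential G <= (1 - (2700 * n%:R)^-1) * potential G.
Proof.
move=> lG st td hv; have [gG _] := lG; have rm := stalled_room st.
have n0 : 0 < n%:R :> R by rewrite ltr0n; have := n1; lia.
have d0 : 0 < d%:R :> R by rewrite ltr0n.
have dn : d%:R <= n%:R :> R by rewrite ler_nat; have := d_small; lia.
have h4 : (d < 8 * #|heavy 4 G|)%N = false.
  apply/negbTE; rewrite -leqNgt; apply: leq_trans hv.
  by rewrite leq_mul2l subset_leq_card ?heavy_sub.
pose N := capped_cut G; pose K : R := 3 * d%:R - (deg G u)%:R.
have NE : N = (cut_size G).+1 by rewrite /N /capped_cut h4.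
have N0 : (0 < N)%N by rewrite NE.
have NR : 0 < N%:R :> R by rewrite ltr0n.
have K0 : 0 <= K by rewrite /K; lra.
have iN01 : 0 <= (N%:R : R)^-1 <= 1 by rewrite invr_ge0 ltW //= invf_le1 // ler1n.
pose b : R := 1 - N%:R^-1.
pose f x w : R := if (x \in body G) && (w \in fresh G x) then b else 1.
pose p x : R := if x \in body G then \sum_(w in fresh G x) step_prob G x w else 0.
have p01 x : 0 <= p x <= 1.
  rewrite /p; case: ifP => _; last by rewrite lexx ler01.
  rewrite sumr_ge0 /=; last by move=> *; apply: step_prob_ge0.
  rewrite -(step_sum1 x n1 gG) [X in _ <= X](bigID (mem (fresh G x))) /= lerDl.
  by apply: sumr_ge0 => *; apply: step_prob_ge0.
have pw c : b ^+ #|new_links G c| = \prod_x f x (c x).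
  rewrite -prodr_const big_mkcond; apply: eq_bigr => x _.
  by rewrite inE /f.
have stepE x : \sum_w step_prob G x w * f x w = 1 - N%:R^-1 * p x.
  rewrite /p /f; case: ifP => xB /=; last first.
    by rewrite mulr0 subr0; under eq_bigr do rewrite mulr1; apply: step_sum1.
  rewrite mulr_sumr [in RHS]big_mkcond -[X in X - _](step_sum1 x n1 gG) -sumrB.
  apply: eq_bigr => w _.
  by case: ifP => _; rewrite /b; ring.
apply: (@le_trans _ _ (\sum_c choice_weight G c *
    (K / N%:R / 2 + K / N%:R / 2 * \prod_x f x (c x)))).
  apply: ler_sum => c _; rewrite ler_wpM2l ?choice_weight_ge0 //.
  apply: (@le_trans _ _ (K / (N + #|new_links G c|)%:R)).
    rewrite /potential; case: ifP => [st'|_]; last by rewrite divr_ge0.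
    have rm' := stalled_room st'.
    apply: ler_pM; rewrite ?invr_ge0 //; first by lra.
      by rewrite /K lerD2l lerN2 ler_nat deg_next.
    rewrite lef_pV2 ?posrE ?ltr0n ?capped_cut_gt0 ?addn_gt0 ?N0 // ler_nat.
    by have := capped_cut_next c lG; rewrite h4.
  have := ler_wpM2l (divr_ge0 K0 (ltW NR)) (ratio_le_power #|new_links G c| N0).
  rewrite mulrA divfK ?gt_eqF // -/b pw => /le_trans-> //.
  by rewrite le_eqVlt; apply/orP; left; apply/eqP; ring.
under eq_bigr do rewrite mulrDr.
rewrite big_split /= -mulr_suml choice_sum1 // mul1r.
under eq_bigr do rewrite mulrCA.
rewrite -mulr_sumr choice_prod; under eq_bigr do rewrite stepE.
have sp := spread_ge lG st td hv.
have cut0 := cut_gt0 lG st td.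
have q01 x : 0 <= N%:R^-1 * p x <= 1.
  by have /andP[? ?] := p01 x; have /andP[? ?] := iN01; rewrite mulr_ge0 // mulr_ile1.
have le1 := prod_le_inv_sum q01.
(* 416 = 2 * 208, because [N], the cut plus one, is at most twice the positive cut. *)
pose a : R := (416 * d%:R)^-1.
have a0 : 0 < a by rewrite invr_gt0 mulr_gt0.
have d1 : 1 <= d%:R :> R by rewrite ler1n.
have a1 : a <= 1 by rewrite invf_le1 ?mulr_gt0 //; lra.
have sa : a <= \sum_x N%:R^-1 * p x.
  rewrite -mulr_sumr /p -big_mkcond /= ler_pdivlMl //; apply: le_trans sp.
  have cR : 1 <= (cut_size G)%:R :> R by rewrite ler1n.
  rewrite ler_pdivlMr ?mulr_gt0 // /a NE -natr1.
  have -> : ((cut_size G)%:R + 1) * (416 * d%:R)^-1 * (208 * d%:R) = ((cut_size G)%:R + 1) / 2 :> R.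
    by field; rewrite gt_eqF.
  lra.
have : \prod_x (1 - N%:R^-1 * p x) <= 1 - a / 2.
  apply: le_trans le1 _; apply: (@le_trans _ _ (1 + a)^-1).
    by rewrite lef_pV2 ?posrE ?lerD2l //; lra.
  rewrite -[X in X <= _]mul1r ler_pdivrMr; nra.
move: (\prod_x _) => P hP.
rewrite /potential st -/K -/N.
have KN : 0 <= K / N%:R by rewrite divr_ge0 // ltW.
(* a/4 = 1/(1664 d) and d <= n: one factor 1/2 comes from [(1 + a)^-1 <= 1 - a/2], the other from
   [ratio_le_power]. *)
have a4 : (2700 * n%:R)^-1 <= a / 4.
  rewrite /a -invfM lef_pV2 ?posrE ?mulr_gt0 //; lra.
move: KN; move: (K / N%:R) => k k0; nra.
Qed.

Lemma potential_decay G : later G ->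
  round_exp potential G <= (1 - (2700 * n%:R)^-1) * potential G.
Proof.
move=> lG; case: (boolP (stalled G)) => st.
  have [td|td] := leqP d (16 * #|tied|)%N.
    exact/potential_decay_gain/gain_tied.
  have [hv|hv] := leqP (8 * #|heavy 8 G|)%N d.
    exact: potential_decay_spread.
  exact/potential_decay_gain/gain_heavy.
rewrite {2}/potential (negbTE st) mulr0 /round_exp big1 // => c _.
by rewrite /potential ifF ?mulr0 //; apply: contraNF st; apply: stalled_next.
Qed.

Lemma potential_ge G : later G -> stalled G ->
  (n%:R ^+ 2)^-1 * d%:R / 2 <= potential G.
Proof.
move=> lG st; have rm := stalled_room st; rewrite /potential st.
have n0 : 0 < n%:R :> R by rewrite ltr0n; have := n1; lia.
have C0 : 0 < (capped_cut G)%:R :> R by rewrite ltr0n capped_cut_gt0.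
have C1 : (capped_cut G)%:R <= 2 * n%:R ^+ 2 :> R.
  rewrite -natrX -natrM ler_nat /capped_cut; case: ifP => _; first by lia.
  (* The identity is an arbitrary choice; only the bound on [cut_size G] is wanted. *)
  have := cut_links_le [ffun x => x] lG; lia.
have kd : d%:R <= 3 * d%:R - (deg G u)%:R :> R.
  have h : (d + deg G u <= 3 * d)%N by move: st; rewrite /stalled; lia.
  by move: h; rewrite -(ler_nat R) natrD natrM; lra.
have -> : (n%:R ^+ 2)^-1 * d%:R / 2 = d%:R * (2 * n%:R ^+ 2)^-1 :> R.
  by field; rewrite gt_eqF.
apply: ler_pM; rewrite ?invr_ge0 ?mulr_ge0 ?exprn_ge0 ?(ltW n0) //.
by rewrite lef_pV2 ?posrE // ?mulr_gt0 ?exprn_gt0.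
Qed.

Lemma potential_le G : later G -> potential G <= 3 * d%:R.
Proof.
move=> lG; rewrite /potential; case: ifP => [st|_]; last by rewrite mulr_ge0.
have rm := stalled_room st.
have C0 : 1 <= (capped_cut G)%:R :> R by rewrite ler1n capped_cut_gt0.
have : 0 <= (deg G u)%:R :> R by [].
rewrite ler_pdivrMr ?(lt_le_trans ltr01) //; nra.
Qed.

(** Markov's inequality: the potential starts at most 3d and is at least d/(2n^2) while [u] is
    stalled, which gives the ratio 6n^2. *)
Lemma stalled_prob (t : nat) :
  iter t (@round_exp n) (fun G => (stalled G)%:R) G0 <=
  6 * n%:R ^+ 2 * (1 - (2700 * n%:R)^-1) ^+ t.
Proof.
have n0 : 0 < n%:R :> R by rewrite ltr0n; have := n1; lia.
have d0 : 0 < d%:R :> R by rewrite ltr0n.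
have q0 : 0 <= 1 - (2700 * n%:R)^-1 :> R.
  rewrite subr_ge0 invf_le1 ?mulr_gt0 //.
  have : 1 <= n%:R :> R by rewrite ler1n; have := n1; lia.
  lra.
have l0 : later G0 by [].
pose k : R := 2 * n%:R ^+ 2 / d%:R.
have k0 : 0 <= k by rewrite divr_ge0 ?mulr_ge0 ?exprn_ge0 ?ltW.
have key G : later G -> iter t (@round_exp n) (fun G => (stalled G)%:R) G <=
    k * (1 - (2700 * n%:R)^-1) ^+ t * potential G.
  elim: t G => [|t IH] G lG.
    rewrite expr0 mulr1 /=; case: (boolP (stalled G)) => st; last first.
      by rewrite /potential (negbTE st) mulr0.
    apply: le_trans (ler_wpM2l k0 (potential_ge lG st)).
    rewrite /= /k le_eqVlt; apply/orP; left; apply/eqP; field.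
    by rewrite !gt_eqF.
  rewrite iterS; apply: (@le_trans _ _ (k * (1 - (2700 * n%:R)^-1) ^+ t * round_exp potential G)).
    rewrite /round_exp mulr_sumr; apply: ler_sum => c _.
    rewrite mulrCA; apply: ler_wpM2l; first exact: choice_weight_ge0.
    exact/IH/later_next.
  have -> : k * (1 - (2700 * n%:R)^-1) ^+ t.+1 * potential G =
      k * (1 - (2700 * n%:R)^-1) ^+ t * ((1 - (2700 * n%:R)^-1) * potential G).
    by rewrite exprSr !mulrA.
  by apply: ler_wpM2l (potential_decay lG); rewrite mulr_ge0 ?exprn_ge0.
apply: le_trans (key _ l0) _.
apply: (@le_trans _ _ (k * (1 - (2700 * n%:R)^-1) ^+ t * (3 * d%:R))).
  by apply: ler_wpM2l (potential_le l0); rewrite mulr_ge0 ?exprn_ge0.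
rewrite /k; move: (_ ^+ t) => q; rewrite le_eqVlt; apply/orP; left; apply/eqP; field.
by rewrite !gt_eqF.
Qed.

End Phase.

(** * Union bounds over vertices and pairs, and the chaining of phases *)

Section Rounds.
Variable n : nat.
Hypothesis n1 : (1 < n)%N.
Implicit Types (G H : graph n) (x y v w : 'I_n) (f g : graph n -> R) (t k d : nat).

Definition rounds t f G : R := iter t (@round_exp n) f G.

Lemma rounds_le t f g G : (forall H, good_graph H -> f H <= g H) ->
  good_graph G -> rounds t f G <= rounds t g G.
Proof.
move=> fg; elim: t G => [|t IH] G gG; first exact: fg.
by apply: round_exp_le => c; apply/IH/next_good.
Qed.

Lemma rounds_affine t (a b : R) f G : good_graph G ->
  rounds t (fun H => a + b * f H) G = a + b * rounds t f G.
Proof.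
elim: t G => // t IH G gG; rewrite /rounds !iterS -(round_exp_affine _ _ _ n1 gG).
by apply: eq_bigr => c _; rewrite -[iter _ _ _ _]/(rounds t _ _) IH //; apply: next_good.
Qed.

Lemma rounds_sum t (I : finType) (F : I -> graph n -> R) G :
  rounds t (fun H => \sum_i F i H) G = \sum_i rounds t (F i) G.
Proof.
elim: t G => // t IH G; rewrite /rounds iterS.
under [RHS]eq_bigr do rewrite iterS.
rewrite -round_exp_sum; apply: eq_bigr => c _.
by congr (_ * _); apply: IH.
Qed.

Lemma roundsD s t f G : rounds (s + t) f G = rounds s (rounds t f) G.
Proof. by rewrite /rounds iterD. Qed.

(** Common failure bound: n vertices at 6n^2 each in a growth phase, and more than the n^2 ordered
    pairs of the final phase. *)
Definition decay t : R := 6 * n%:R ^+ 3 * (1 - (2700 * n%:R)^-1) ^+ t.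
Definition min_deg d G : Prop := forall x, (d <= deg G x)%N.
(** Rounding 33d/32 up makes this exceed [d] already for d = 1. *)
Definition grow d : nat := ((33 * d + 31) %/ 32)%N.

Let nR : 2 <= n%:R :> R. Proof. by rewrite ler_nat. Qed.
Let nR0 : 0 < n%:R :> R. Proof. by have := nR; lra. Qed.
Let q0 : 0 <= 1 - (2700 * n%:R)^-1 :> R.
Proof. by rewrite subr_ge0 invf_le1 ?mulr_gt0 //; have := nR; lra. Qed.

Lemma grow_prob d t G : good_graph G -> (0 < d)%N -> (3 * d + 2 <= 2 * n)%N ->
  min_deg d G ->
  rounds t (fun H => (~~ [forall x, grow d <= deg H x]%N)%:R) G <= decay t.
Proof.
move=> gG d0 dn dG.
apply: (@le_trans _ _ (rounds t (fun H => \sum_x (stalled x d H)%:R) G)).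
  apply: rounds_le => // H gH; case: forallP => [_|/= nf]; first by apply: sumr_ge0.
  have [x hx] : exists x, ~~ (grow d <= deg H x)%N.
    by apply/existsP; rewrite -negb_forall; apply/forallP.
  have st : stalled x d H.
    by move: hx; rewrite /stalled /grow -ltnNge; have := leq_trunc_div (33 * d + 31) 32; lia.
  by rewrite (bigD1 x) //= st lerDl; apply: sumr_ge0.
rewrite rounds_sum; apply: (@le_trans _ _ (\sum_(x < n) (6 * n%:R ^+ 2 * (1 - (2700 * n%:R)^-1) ^+ t))).
  by apply: ler_sum => x _; apply: stalled_prob.
rewrite sumr_const card_ord -mulr_natl /decay.
by rewrite le_eqVlt; apply/orP; left; apply/eqP; rewrite !exprS expr0; ring.
Qed.

Definition incomplete G : R := (G != complete_graph n)%:R.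

Lemma complete_next c : next_graph (complete_graph n) c = complete_graph n.
Proof.
apply/setP => -[x y]; rewrite nextP [RHS]inE [X in X || _]inE /=.
by case: (x != y).
Qed.

Lemma rounds_incomplete_le t G : good_graph G -> rounds t incomplete G <= incomplete G.
Proof.
elim: t G => // t IH G gG; rewrite /rounds iterS.
apply: (@le_trans _ _ (round_exp (fun _ => incomplete G) G)); last first.
  by rewrite /round_exp -mulr_suml choice_sum1 // mul1r.
apply: ler_sum => c _; apply: ler_wpM2l; first exact: choice_weight_ge0.
apply: le_trans (IH _ _) _; first exact: next_good.
rewrite /incomplete; case: (eqVneq G (complete_graph n)) => [->|_] /=.
  by rewrite complete_next eqxx.
by rewrite lern1 leq_b1.
Qed.

(** Both neighbourhoods avoid [x] and [y], so they share at least 2d - (n - 2) >= n/3 vertices. *)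
Lemma common_nbrs d G x y : good_graph G -> (2 * n <= 3 * d + 1)%N -> min_deg d G ->
  x != y -> y \notin nbr G x -> (n <= 3 * #|nbr G x :&: nbr G y|)%N.
Proof.
move=> [sG _] dn dG xy xyN.
have : (#|nbr G x :|: nbr G y| <= #|~: [set x; y]|)%N.
  apply: subset_leq_card; apply/subsetP => z; rewrite in_setU in_setC in_set2 negb_or.
  case/orP => [zx|zy].
    by rewrite eq_sym (nbr_neq sG zx); apply: contraNneq xyN => <-.
  by rewrite andbC eq_sym (nbr_neq sG zy); apply: contraNneq xyN => <-; rewrite nbr_sym.
have := cardsC [set x; y]; rewrite cards2 xy card_ord.
have := cardsUI (nbr G x) (nbr G y); have := dG x; have := dG y; rewrite /deg.
move: dn; move: #|nbr G x| #|nbr G y| #|_ :|: _| #|_ :&: _| #|~: _|; clear; lia.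
Qed.

(** At least n/3 midpoints with probability 1/n^2 each give 1/(3n); the weaker constant lets the
    growth phases and the final phase share [decay]. *)
Lemma link_prob d G x y : good_graph G -> (2 * n <= 3 * d + 1)%N -> min_deg d G ->
  x != y -> y \notin nbr G x -> (2700 * n%:R)^-1 <= step_prob G x y.
Proof.
move=> gG dn dG xy xyN; have [sG _] := gG; have cn := common_nbrs gG dn dG xy xyN.
have -> : step_prob G x y = \sum_(w in [set y]) step_prob G x w by rewrite big_set1.
rewrite step_set ?deg_gt0 //.
have inv z : n%:R^-1 <= (deg G z)%:R^-1 :> R.
  by rewrite lef_pV2 ?posrE ?nR0 ?ltr0n ?deg_gt0 // ler_nat ltnW // deg_ltn.
apply: (@le_trans _ _ (\sum_(v in nbr G x :&: nbr G y) n%:R^-1 * n%:R^-1)).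
  have : n%:R <= 3 * #|nbr G x :&: nbr G y|%:R :> R by move: cn; rewrite -(ler_nat R) natrM.
  have -> : \sum_(v in nbr G x :&: nbr G y) n%:R^-1 * n%:R^-1 =
      #|nbr G x :&: nbr G y|%:R / n%:R / n%:R :> R.
    by rewrite sumr_const -[LHS]mulr_natl mulrA.
  move: #|_| => m hm.
  rewrite invfM ler_wpM2r ?invr_ge0 ?(ltW nR0) // ler_pdivlMr //; have := nR0; lra.
rewrite [X in _ <= X](big_setID (nbr G y)) /= ler_wpDr //.
  by apply: sumr_ge0 => v _; rewrite !mulr_ge0 ?invr_ge0.
apply: ler_sum => v; rewrite in_setI => /andP[_ vy].
apply: ler_pM; rewrite ?invr_ge0 ?mulr_ge0 ?invr_ge0 ?(ltW nR0) //.
have -> : nbr G v :&: [set y] = [set y].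
  by apply/setIidPr; rewrite sub1set nbr_sym.
by rewrite cards1 mulr1.
Qed.

Lemma complete_prob d t G : good_graph G -> (2 * n <= 3 * d + 1)%N -> min_deg d G ->
  rounds t incomplete G <= decay t.
Proof.
move=> gG dn dG.
pose miss (e : 'I_n * 'I_n) H : R := ((e.1 != e.2) && (e.2 \notin nbr H e.1))%:R.
apply: (@le_trans _ _ (rounds t (fun H => \sum_e miss e H) G)).
  apply: rounds_le => // H gH; have [[_ iH] _] := gH; rewrite /incomplete.
  case: (eqVneq H (complete_graph n)) => [_|/eqP HN] /=; first by apply: sumr_ge0.
  have [[x y] /andP[xy xyN]] : exists e : 'I_n * 'I_n, (e.1 != e.2) && (e.2 \notin nbr H e.1).
    apply/existsP; apply: contra_notT HN => /existsPn al; apply/setP => -[x y].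
    have := al (x, y); rewrite /= nbrP inE /=; case: eqVneq => [->|] /=.
      by rewrite (negbTE (iH y)).
    by move=> _ /negbNE.
  by rewrite (bigD1 (x, y)) //= /miss /= xy xyN lerDl; apply: sumr_ge0.
rewrite rounds_sum; apply: (@le_trans _ _ (\sum_(e : 'I_n * 'I_n) (1 - (2700 * n%:R)^-1) ^+ t)).
  apply: ler_sum => -[x y] _.
  suff key H : good_graph H -> min_deg d H ->
      rounds t (miss (x, y)) H <= (1 - (2700 * n%:R)^-1) ^+ t * miss (x, y) H.
    apply: le_trans (key _ gG dG) _; rewrite -[X in _ <= X]mulr1 ler_wpM2l ?exprn_ge0 //.
    by rewrite lern1 leq_b1.
  elim: t H => [|t IH] H gH dH; first by rewrite expr0 mul1r.
  rewrite /rounds iterS exprSr -mulrA.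
  apply: (@le_trans _ _ ((1 - (2700 * n%:R)^-1) ^+ t * round_exp (miss (x, y)) H)).
    rewrite /round_exp mulr_sumr; apply: ler_sum => c _.
    rewrite mulrCA; apply: ler_wpM2l; first exact: choice_weight_ge0.
    apply: IH; first exact: next_good.
    by move=> z; apply: leq_trans (dH z) _; apply: deg_next.
  apply: ler_wpM2l; first exact: exprn_ge0.
  rewrite /miss /=; case: (boolP (_ && _)) => [/andP[xy xyN]|]; last first.
    move=> adjxy; rewrite mulr0 /round_exp big1 // => c _.
    case: eqVneq adjxy => [//|xy] /=; first by rewrite mulr0.
    rewrite negbK => yN; rewrite (subsetP (nbr_sub x (next_sub H c)) _ yN) /=.
    by rewrite mulr0.
  rewrite mulr1.
  apply: (@le_trans _ _ (\sum_c choice_weight H c * (1 - (c x == y)%:R))).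
    apply: ler_sum => c _; apply: ler_wpM2l; first exact: choice_weight_ge0.
    rewrite xy nbrP nextP xy eq_sym /=; case: (c x == y); rewrite ?orbT ?subrr //=.
    by rewrite subr0 lern1 leq_b1.
  rewrite (choice_marginal x (fun w => 1 - (w == y)%:R)) //.
  under eq_bigr do rewrite mulrBr mulr1.
  rewrite sumrB step_sum1 // (bigD1 y) //= eqxx mulr1 big1; last first.
    by move=> w /negbTE->; rewrite mulr0.
  by rewrite addr0 lerD2l lerN2; apply: link_prob gH dn dH xy xyN.
rewrite sumr_const card_prod card_ord -[X in X <= _]mulr_natl /decay natrM.
rewrite ler_wpM2r ?exprn_ge0 // !exprS expr0; have := nR; nra.
Qed.

(** There are [k] growth phases and a final one, each failing with probability at most 1/n. If the
    degrees are large early, the remaining rounds do no harm, since completeness persists. *)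
Lemma incomplete_prob tau k d G : decay tau <= n%:R^-1 ->
  good_graph G -> (0 < d)%N -> min_deg d G -> (2 * n <= 3 * iter k grow d + 1)%N ->
  rounds (tau * k.+1) incomplete G <= k.+1%:R / n%:R.
Proof.
move=> htau; elim: k d G => [|k IH] d G gG d0 dG hk.
  by rewrite muln1 mul1r; apply: le_trans htau; apply: complete_prob gG hk dG.
rewrite mulnS roundsD.
have [big|small] := leqP (2 * n) (3 * d + 1).
  apply: (@le_trans _ _ (rounds tau incomplete G)).
    by apply: rounds_le => // H; apply: rounds_incomplete_le.
  apply: le_trans (complete_prob _ gG big dG) _; apply: le_trans htau _.
  by rewrite -[X in X <= _]mul1r ler_wpM2r ?invr_ge0 ?(ltW nR0) // ler1n.
apply: (@le_trans _ _ (rounds tau (fun H => k.+1%:R / n%:R +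
    1 * (~~ [forall x, grow d <= deg H x]%N)%:R) G)).
  apply: rounds_le => // H gH; rewrite mul1r.
  case: forallP => [al|_] /=.
    rewrite addr0; apply: (IH (grow d)) => //; last by rewrite -iterSr.
    rewrite /grow divn_gt0 //; lia.
  apply: le_trans (rounds_incomplete_le _ gH) _.
  rewrite /incomplete ler_wpDl ?divr_ge0 ?(ltW nR0) //.
  by rewrite ler_nat leq_b1.
rewrite rounds_affine // mul1r.
apply: (@le_trans _ _ (k.+1%:R / n%:R + n%:R^-1)).
  rewrite lerD2l; apply: le_trans htau; apply: grow_prob => //; lia.
by rewrite -[k.+2]addn1 natrD mulrDl mul1r.
Qed.

Lemma twohop_complete t G : good_graph G ->
  twohop_dist G t (complete_graph n) = 1 - rounds t incomplete G.
Proof.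
move=> gG; have -> : 1 - rounds t incomplete G =
    rounds t (fun H => 1 + -1 * incomplete H) G by rewrite rounds_affine // mulN1r.
rewrite -[RHS](twohop_distE G t) (bigD1 (complete_graph n)) //= big1.
  by rewrite /incomplete eqxx mulr0 !addr0 mulr1.
by move=> H HN; rewrite /incomplete HN mulN1r subrr mulr0.
Qed.

End Rounds.

(** * Estimates with exp and ln, and the choice of constants *)

Lemma exp_ge1Dx (x : R) : 1 + x <= exp x.
Proof. exact/RleP/exp_ineq1_le. Qed.

Lemma exp_ge0 (x : R) : 0 <= exp x.
Proof. exact/ltW/RltP/exp_pos. Qed.

Lemma exp_homo (x y : R) : x <= y -> exp x <= exp y.
Proof.
rewrite le_eqVlt => /orP[/eqP->//|/RltP xy].
by apply/ltW/RltP/exp_increasing.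
Qed.

Lemma exp_ln_nat (n : nat) : (0 < n)%N -> exp (ln n%:R) = n%:R.
Proof. by move=> n0; rewrite exp_ln //; apply/RltP; rewrite ltr0n. Qed.

Lemma ln_ge_half (n : nat) : (1 < n)%N -> 2^-1 <= ln n%:R.
Proof.
move=> n1; apply: (@le_trans _ _ (ln 2)); first by apply/ltW/RltP; apply: ln_lt_2.
have [->//|n2] := eqVneq n 2%N.
apply/ltW/RltP/ln_increasing; apply/RltP => //.
by rewrite -[2]/(2%:R) ltr_nat; lia.
Qed.

(** The power is at most n^-7, which leaves a factor 6/n^3 <= 1 for n >= 2; exponent 6 would leave
    6/n^2, too large at n = 2. *)
Lemma decay_le (n t : nat) : (1 < n)%N -> 7 * 2700 * n%:R * ln n%:R <= t%:R ->
  decay n t <= n%:R^-1.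
Proof.
move=> n1 ht.
have nR : 2 <= n%:R :> R by rewrite ler_nat.
have n0 : 0 < n%:R :> R by rewrite ltr0n ltnW.
have x0 : 0 <= 1 - (2700 * n%:R)^-1 :> R by rewrite subr_ge0 invf_le1 ?mulr_gt0 //; lra.
have p : (1 - (2700 * n%:R)^-1) ^+ t <= n%:R ^- 7 :> R.
  apply: (@le_trans _ _ (exp (- (2700 * n%:R)^-1) ^+ t)).
    by apply: lerXn2r; rewrite ?nnegrE ?exp_ge0 //; apply: exp_ge1Dx.
  have e7 : exp (- (ln n%:R *+ 7)) = n%:R ^- 7.
    by rewrite -RoppE exp_Ropp RinvE -expRX exp_ln_nat // ltnW.
  rewrite expRX -e7; apply: exp_homo.
  rewrite mulNrn lerN2 -[X in _ <= X]mulr_natl -[X in X <= _]mulr_natl ler_pdivlMr ?mulr_gt0 //.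
  by apply: le_trans ht; lra.
rewrite /decay; apply: (@le_trans _ _ (6 * n%:R ^+ 3 * n%:R ^- 7)).
  by rewrite ler_wpM2l // mulr_ge0 ?exprn_ge0 ?ltW.
have -> : 6 * n%:R ^+ 3 * n%:R ^- 7 = 6 / n%:R ^+ 3 / n%:R :> R.
  by field; rewrite gt_eqF.
rewrite -[X in _ <= X]mul1r ler_wpM2r ?invr_ge0 ?(ltW n0) // ler_pdivrMr ?exprn_gt0 // mul1r.
have : 2 ^+ 3 <= n%:R ^+ 3 :> R by apply: lerXn2r; rewrite ?nnegrE ?(ltW n0).
by apply: le_trans; rewrite -natrX ler_nat.
Qed.

(** exp(-1/33) >= 32/33, so 33/32 >= exp(1/33), and [k] phases multiply the bound by at least
    exp(k/33) >= n. *)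
Lemma grow_iter (n k : nat) : (1 < n)%N -> 33 * ln n%:R <= k%:R ->
  (n <= iter k grow 1)%N.
Proof.
move=> n1 hk; rewrite -(ler_nat R).
have gr : (33 / 32) ^+ k <= (iter k grow 1)%:R :> R.
  elim: k {hk} => [|k IH]; first by rewrite expr0.
  have : (33 * iter k grow 1 <= 32 * iter k.+1 grow 1)%N.
    by rewrite iterS /grow; move: (iter _ _ _) => d; lia.
  rewrite -(ler_nat R) !natrM exprS; lra.
apply: le_trans gr; rewrite -(exp_ln_nat (ltnW n1)).
apply: (@le_trans _ _ (exp (33^-1) ^+ k)).
  by rewrite expRX; apply: exp_homo; rewrite -[X in _ <= X]mulr_natr; lra.
apply: lerXn2r; [by rewrite nnegrE exp_ge0|by rewrite nnegrE; lra|].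
have : exp 33^-1 * exp (- 33^-1) = 1 by rewrite expRD RplusE subrr expR0.
have := exp_ge1Dx (- 33^-1); have := exp_ge0 33^-1.
move: (exp _) (exp _) => a b; nra.
Qed.

Lemma exists_nat_ceil (x : R) : 0 <= x -> exists k : nat, x <= k%:R <= x + 1.
Proof.
move=> x0; exists (Num.truncn x).+1; have /andP[h1 h2] := truncn_itv x0.
by rewrite (ltW h2) /= -natr1 lerD2r.
Qed.

Lemma twohop_complete_ge (n t : nat) (G : graph n) : (1 < n)%N -> good_graph G ->
  37 * 7 * 2701 * n%:R * ln n%:R ^+ 2 <= t%:R ->
  1 - 37 * ln n%:R / n%:R <= twohop_dist G t (complete_graph n).
Proof.
move=> n1 gG ht.
have L := ln_ge_half n1.
have nR : 2 <= n%:R :> R by rewrite ler_nat.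
have n0 : 0 < n%:R :> R by lra.
have [|k /andP[k1 k2]] := @exists_nat_ceil (33 * ln n%:R); first by lra.
have [|tau /andP[t1 t2]] := @exists_nat_ceil (7 * 2700 * n%:R * ln n%:R); first by nra.
have dec := decay_le n1 t1.
(* [ln n >= 1/2] absorbs the roundings: 33 ln n + 2 <= 37 ln n, and the 1 added in [tau] is at most
   7 n ln n. *)
have kR : k.+1%:R <= 37 * ln n%:R :> R by rewrite -natr1; lra.
have tR : tau%:R <= 7 * 2701 * (n%:R * ln n%:R) :> R by nra.
have tt : (tau * k.+1 <= t)%N.
  rewrite -(ler_nat R) natrM; apply: le_trans ht.
  apply: (@le_trans _ _ (7 * 2701 * (n%:R * ln n%:R) * (37 * ln n%:R))).
    by apply: ler_pM.
  by rewrite le_eqVlt; apply/orP; left; apply/eqP; ring.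
rewrite twohop_complete // lerD2l lerN2.
(* Rounds beyond the last phase cannot undo completeness. *)
apply: (@le_trans _ _ (rounds (tau * k.+1) (@incomplete n) G)).
  rewrite -(subnKC tt) roundsD; apply: rounds_le => // H gH.
  exact: rounds_incomplete_le.
apply: le_trans (@incomplete_prob n n1 tau k 1 G dec gG _ _ _) _ => //.
- by move=> x; apply: deg_gt0.
- by move: (grow_iter n1 k1); move: (iter k grow 1) => g; clear; lia.
by rewrite ler_wpM2r ?invr_ge0 ?(ltW n0).
Qed.

Local Close Scope ring_scope.
Local Open Scope R_scope.

(* T = ceil(C n log^2 n) is characterised by  T - 1 < C n ln(n)^2 <= T. *)
Theorem theorem12 :
  exists C C' : R, 0 < C /\ 0 < C' /\
  forall (n : nat), (2 <= n)%N ->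
  forall (G0 : graph n), simple_undirected G0 -> connected_graph G0 ->
  forall T : nat,
    INR T - 1 < C * INR n * (ln (INR n)) ^ 2 <= INR T ->
    1 - C' * ln (INR n) / INR n <= twohop_dist G0 T (complete_graph n).
Proof.
exists (37 * 7 * 2701)%R, 37%R; split; first by apply/RltP; rewrite !mulr_gt0.
split; first by apply/RltP; rewrite ltr0n.
move=> n n1 G0 sG cG T [_ /RleP hT]; apply/RleP.
move: hT; rewrite !RealsE.
exact: twohop_complete_ge.
Qed.
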